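(* Let $0<\epsilon<1$, $0<\delta<1/2$ and $n>1/\epsilon$. Any algorithm that solves the uniformity testing problem for $\ell_\infty$ distance with tolerance $\epsilon$ and failure probability $\delta$ on support size $n$ must draw at least $m=\frac{1-2\delta}{2}\cdot\frac1\epsilon$ samples.
   Context: A distribution on support size $n$ is a vector $A\in\mathbb{R}^n$, $A_i\ge0$, $\sum_iA_i=1$; $U_n$ is uniform; $\|V\|_\infty=\max_i|V_i|$. Uniformity testing: given $n,\epsilon,\delta$ and i.i.d. samples from an unknown distribution $A$ on $\{1,\dots,n\}$, the algorithm draws $m$ samples and must output ``uniform'' with probability at least $1-\delta$ if $A=U_n$, and ``not uniform'' with probability at least $1-\delta$ if $\|A-U_n\|_\infty\ge\epsilon$.
   Formalization: The case m = 0 is excluded when no distribution on n points is at distance at least ε from uniform; there the claim fails (e.g. n = 2, ε = 0.9: always answering ''uniform'' with no samples solves the problem). *)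

(* Defs.v *)
From HB Require Import structures.
From mathcomp Require Export all_boot all_order all_algebra.
From mathcomp Require Export all_classical all_reals all_analysis.

Set Implicit Arguments.
Unset Strict Implicit.
Unset Printing Implicit Defensive.

Import Order.TTheory GRing.Theory Num.Theory.
Import numFieldNormedType.Exports.

Local Open Scope classical_set_scope.
Local Open Scope ring_scope.

Definition is_distribution (R : realType) (n : nat) (A : 'rV[R]_n) : Prop :=
  (forall i : 'I_n, 0 <= A ord0 i) /\ \sum_(i < n) A ord0 i = 1.

Definition uniform (R : realType) (n : nat) : 'rV[R]_n := const_mx n%:R^-1.

(* The norm on 'rV[R]_n is the maximum of the absolute values of the entries,
   so this is the l_infinity distance condition. *)
Definition far_from_uniform (R : realType) (n : nat) (eps : R)
    (A : 'rV[R]_n) : Prop :=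
  eps <= `|A - uniform R n|.

(* A possibly randomized algorithm drawing m samples from {0, ..., n-1}: its
   internal randomness is a point of an arbitrary probability space,
   independent of the samples. The output true means "uniform", false means
   "not uniform". *)
Record algorithm (R : realType) (n m : nat) := Algorithm {
  seed_display : measure_display ;
  seed : measurableType seed_display ;
  seed_law : probability seed R ;
  decide : m.-tuple 'I_n -> seed -> bool ;
  measurable_decide : forall s, measurable_fun [set: seed] (decide s)
}.

Arguments decide {R n m} alg s w : rename.

(* The m samples are i.i.d. of law A, so the tuple s has probability
   \prod_(j < m) A_{s_j}; the seed is independent of the samples. *)
Definition output_probability (R : realType) (n m : nat)
    (alg : algorithm R n m) (A : 'rV[R]_n) (b : bool) : R :=
  \sum_(s : m.-tuple 'I_n)
    (\prod_(j < m) A ord0 (tnth s j)) *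
    fine (seed_law alg [set w | decide alg s w = b]).

Definition solves_uniformity_testing (R : realType) (n m : nat)
    (eps delta : R) (alg : algorithm R n m) : Prop :=
  1 - delta <= output_probability alg (uniform R n) true /\
  (forall A : 'rV[R]_n, is_distribution A -> far_from_uniform eps A ->
     1 - delta <= output_probability alg A false).

(* Main.v *)
(* Mixing the uniform law with a point mass of weight t = eps / (1 - 1/n) gives
   a law A at l_infinity distance exactly eps from uniform, and t <= 2 eps.
   Since A >= (1 - t) U pointwise, every event of m samples has A-probability
   at least (1 - t)^m >= 1 - m t times its U-probability.  Hence A is accepted
   with probability at least (1 - m t)(1 - delta), which must be at most delta.
   If t > 1 the mixture is not a distribution, but then eps > 1/2 and a single
   sample already meets the bound. *)
Require Import Defs.
From mathcomp Require Import all_boot all_order all_algebra.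
From mathcomp Require Import all_classical all_reals all_analysis.
From mathcomp Require Import lra.
Import Order.TTheory GRing.Theory Num.Theory.
Import numFieldNormedType.Exports.
Local Open Scope ring_scope.

Lemma bernoulli_inequality (R : realDomainType) (t : R) (m : nat) :
  0 <= t <= 1 -> 1 - m%:R * t <= (1 - t) ^+ m.
Proof.
move=> /andP[t0 t1]; elim: m => [|m IH]; first by rewrite expr0 mul0r subr0.
rewrite exprS -natr1.
apply: (@le_trans _ _ ((1 - t) * (1 - m%:R * t))); last first.
  by rewrite ler_wpM2l// subr_ge0.
(* Expanding [(1 - t) * (1 - m%:R * t)] leaves exactly this term over the target. *)
have : 0 <= m%:R * t * t by rewrite !mulr_ge0.
lra.
Qed.

(** Distributivity expands the power into one term per function from ['I_m] to ['I_n]; these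
    functions are the tuples. *)
Lemma sum_tuple_prod (R : comPzSemiRingType) (n m : nat) (F : 'I_n -> R) :
  \sum_(s : m.-tuple 'I_n) \prod_(j < m) F (tnth s j) = (\sum_i F i) ^+ m.
Proof.
rewrite -[in RHS](card_ord m) -prodr_const bigA_distr_bigA/=.
rewrite (reindex (@tuple_of_finfun 'I_n m))/=; last first.
  exists (@finfun_of_tuple 'I_n m) => s _.
    exact: tuple_of_finfunK.
  exact: finfun_of_tupleK.
by apply: eq_bigr => f _; apply: eq_bigr => j _; rewrite tnth_map tnth_ord_tuple.
Qed.

(** For each sample tuple the two outputs are complementary seed events, and the tuple weights have
    total mass 1. *)
Lemma output_probabilityC (R : realType) (n m : nat) (alg : algorithm R n m)
    (A : 'rV[R]_n) : is_distribution A ->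
  output_probability alg A true + output_probability alg A false = 1.
Proof.
move=> [_ A1]; rewrite /output_probability -big_split/=.
transitivity ((\sum_i A ord0 i) ^+ m); last by rewrite A1 expr1n.
rewrite -sum_tuple_prod; apply: eq_bigr => s _.
rewrite -mulrDr -[RHS]mulr1; congr (_ * _).
set E := [set w | decide alg s w = true]%classic.
have mE : measurable E.
  have := @measurable_decide _ _ _ alg s measurableT [set true]%classic.
  by rewrite setTI; apply.
have -> : [set w | decide alg s w = false]%classic = (~` E)%classic.
  by apply/seteqP; split => w /=; rewrite /E/=; case: decide.
rewrite probability_setC// fineB ?fin_num_measure//=.
by rewrite addrC subrK.
Qed.

Lemma output_probability_ge (R : realType) (n m : nat) (alg : algorithm R n m)
    (A B : 'rV[R]_n) (c : R) (b : bool) :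
  0 <= c -> (forall i, 0 <= B ord0 i) ->
  (forall i, c * B ord0 i <= A ord0 i) ->
  c ^+ m * output_probability alg B b <= output_probability alg A b.
Proof.
move=> c0 B0 cBA; rewrite /output_probability mulr_sumr.
apply: ler_sum => s _; rewrite mulrA ler_wpM2r ?fine_ge0//.
rewrite -[in c ^+ m](card_ord m) -prodr_const -big_split/=.
by apply: ler_prod => j _; rewrite cBA mulr_ge0.
Qed.

Lemma sample_size_ge (R : realType) (n m : nat) (eps delta t : R)
    (alg : algorithm R n m) (A : 'rV[R]_n) :
  0 <= delta -> 0 <= t <= 1 ->
  is_distribution A -> far_from_uniform eps A ->
  (forall i, (1 - t) * uniform R n ord0 i <= A ord0 i) ->
  solves_uniformity_testing eps delta alg ->
  1 - 2 * delta <= m%:R * t.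
Proof.
move=> d0 t01 distA farA UA [accU rejA].
have {rejA} rejA := rejA A distA farA.
have sumA := output_probabilityC _ _ _ alg _ distA.
have t1 : 0 <= 1 - t by rewrite subr_ge0; case/andP: t01.
have mt0 : 0 <= m%:R * t by rewrite mulr_ge0//; case/andP: t01.
have U0 i : 0 <= uniform R n ord0 i by rewrite mxE invr_ge0 ler0n.
have leA := output_probability_ge _ _ _ alg A _ _ true t1 U0 UA.
have bern := bernoulli_inequality _ _ m t01.
have ct1 : (1 - t) ^+ m <= 1.
  by rewrite exprn_ile1// lerBlDr lerDl; case/andP: t01.
have : (1 - t) ^+ m * (1 - delta) <= delta.
  apply: le_trans (_ : output_probability alg A true <= _); last by lra.
  by apply: le_trans leA; rewrite ler_wpM2l// exprn_ge0.
(* With [c = (1 - t) ^+ m], the bounds [c * (1 - delta) <= delta] and [c * delta <= delta] give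
   [c <= 2 * delta]; Bernoulli bounds [c] below. *)
have : 0 <= (1 - (1 - t) ^+ m) * delta by rewrite mulr_ge0// subr_ge0.
lra.
Qed.

Lemma le_mx_norm (R : realType) (n : nat) (v : 'rV[R]_n) (i : 'I_n) :
  `|v ord0 i| <= `|v|.
Proof.
rewrite [leRHS]/Num.norm/= mx_normrE.
exact: (le_bigmax _ (fun ij => `|v ij.1 ij.2|) (ord0, i)).
Qed.

(** The support size is a successor so that [ord0] can carry the point mass. *)
Definition spiked (R : realType) (n : nat) (t : R) : 'rV[R]_n.+1 :=
  (1 - t) *: uniform R n.+1 + t *: delta_mx ord0 ord0.

Lemma spikedE (R : realType) (n : nat) (t : R) (i : 'I_n.+1) :
  spiked R n t ord0 i = (1 - t) / n.+1%:R + t * (i == ord0)%:R.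
Proof. by rewrite !mxE eqxx. Qed.

Lemma spiked_ge (R : realType) (n : nat) (t : R) (i : 'I_n.+1) :
  0 <= t -> (1 - t) * uniform R n.+1 ord0 i <= spiked R n t ord0 i.
Proof. by move=> t0; rewrite spikedE mxE lerDl mulr_ge0. Qed.

Lemma spiked_distribution (R : realType) (n : nat) (t : R) :
  0 <= t <= 1 -> is_distribution (spiked R n t).
Proof.
move=> /andP[t0 t1]; split=> [i|].
  by rewrite spikedE addr_ge0// ?mulr_ge0// ?subr_ge0// invr_ge0.
under eq_bigr do rewrite spikedE.
rewrite big_split/= sumr_const card_ord -mulr_sumr (bigD1 ord0)//=.
rewrite big1 => [|i /negPf->//]; rewrite -[X in X + _]mulr_natr divfK ?pnatr_eq0//.
by rewrite addr0 mulr1 subrK.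
Qed.

(** The entry at [ord0] alone already deviates from the uniform value by this amount. *)
Lemma spiked_far (R : realType) (n : nat) (t : R) :
  far_from_uniform (t * (1 - n.+1%:R^-1)) (spiked R n t).
Proof.
apply: le_trans (le_mx_norm _ _ _ ord0); apply: le_trans (ler_norm _).
by rewrite mxE spikedE !mxE eqxx mulr1; set u := _^-1; lra.
Qed.

Theorem theorem13 (R : realType) (n m : nat) (eps delta : R)
    (eps_gt0 : 0 < eps) (eps_lt1 : eps < 1)
    (delta_gt0 : 0 < delta) (delta_lt_half : delta < 1 / 2)
    (n_large : 1 / eps < n%:R)
    (* m = 0 is excluded only if no distribution is eps-far from uniform *)
    (nondegenerate : (0 < m)%N \/
       exists A : 'rV[R]_n, is_distribution A /\ far_from_uniform eps A)
    (alg : algorithm R n m)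
    (alg_solves : solves_uniformity_testing eps delta alg) :
  (1 - 2 * delta) / 2 * (1 / eps) <= m%:R.
Proof.
have d0 := ltW delta_gt0.
have {nondegenerate} m_gt0 : (0 < m)%N.
  case: nondegenerate => // -[A [distA farA]].
  case: (posnP m) => // m0; subst m; exfalso.
  (* t = 1 imposes nothing on A but nonnegativity, and (1 - t) ^+ 0 = 1. *)
  have UA i : (1 - 1) * uniform R n ord0 i <= A ord0 i.
    by rewrite subrr mul0r; case: distA.
  have t01 : 0 <= (1 : R) <= 1 by rewrite ler01 lexx.
  have := sample_size_ge _ _ _ _ _ _ alg A d0 t01 distA farA UA alg_solves.
  by lra.
(* As [1 / eps > 1], the support has at least two points, whence [u <= 1 / 2] below. *)
have n_gt1 : (1 < n)%N.
  rewrite -(ltr_nat R); apply: lt_trans n_large.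
  by rewrite ltr_pdivlMr// mul1r.
case: n n_large n_gt1 alg alg_solves => // n _ n_gt0 alg alg_solves.
have u_le : (n.+1%:R^-1 : R) <= 2^-1 by rewrite lef_pV2 ?posrE// ler_nat.
set u : R := n.+1%:R^-1 in u_le.
have u1 : 0 < 1 - u by lra.
have goalE : 1 - 2 * delta <= m%:R * (2 * eps) ->
    (1 - 2 * delta) / 2 * (1 / eps) <= m%:R.
  by rewrite mul1r ler_pdivrMr// ler_pdivrMr// -mulrA [eps * 2]mulrC.
have m0 : 0 <= m%:R :> R by [].
apply: goalE; have [t1|t1] := leP (eps / (1 - u)) 1; last first.
  (* Here [eps > 1 - u >= 1 / 2], so [2 * eps] alone exceeds [1 - 2 * delta]. *)
  have m1 : 1 <= m%:R :> R by rewrite ler1n.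
  move: t1; rewrite ltr_pdivlMr// mul1r => t1.
  by apply: (@le_trans _ _ (1 * (2 * eps))); [lra | rewrite ler_wpM2r//; lra].
set t := eps / (1 - u) in t1.
have t0 : 0 <= t by rewrite divr_ge0// ltW.
have t01 : 0 <= t <= 1 by rewrite t0.
have farA := spiked_far R n t.
rewrite -/u (_ : t * (1 - u) = eps) in farA; last by rewrite divfK ?gt_eqF.
apply: le_trans (sample_size_ge _ _ _ _ _ _ alg _ d0 t01
  (spiked_distribution _ _ _ t01) farA (fun i => spiked_ge _ _ _ i t0)
  alg_solves) _.
rewrite ler_wpM2l// ler_pdivrMr//.
(* The claim [t <= 2 * eps] has become [eps <= 2 * eps * (1 - u)], that is
   [0 <= eps * (1 - 2 * u)]. *)
by have := mulr_ge0 (ltW eps_gt0) (_ : 0 <= 1 - 2 * u); lra.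
Qed.
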